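(* Let $n\ge 1$ and let $p=(p_1,\dots,p_n) \in \mathbb{C}\langle x_1,\dots,x_n\rangle^n$ be an $n$-tuple of noncommutative polynomials. Then the following statements are equivalent: (i) $p$ is a cyclic gradient, i.e., there exists $q\in \mathbb{C}\langle x_1,\dots,x_n\rangle$ such that $p_i = \mathcal{D}_i q$ for all $i=1,\dots,n$. (ii) $\sum_{j=1}^n [x_j,p_j]=0$. (iii) For $i,j=1,\dots,n$, we have $\partial_i p_j = \sigma(\partial_j p_i)$. (iv) For $i=1,\dots,n$, we have $\mathcal{D}_i\big(\sum_{j=1}^n x_jp_j\big) = (N+\mathrm{id})p_i$. When these equivalent conditions are satisfied, a noncommutative polynomial $q$ with $\mathcal{D}_i q=p_i$ for all $i=1,\dots,n$ can be found by solving the equation $Nq=\sum_{j=1}^n x_jp_j$; that is, this equation has a solution $q\in\mathbb{C}\langle x_1,\dots,x_n\rangle$, and every solution $q$ satisfies $\mathcal{D}_iq=p_i$ for all $i$.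
   Context: $\mathbb{C}\langle x_1,\dots,x_n\rangle$ is the unital complex algebra of noncommutative polynomials in formal non-commuting variables $x_1,\dots,x_n$ (the free algebra); $\otimes$ is the algebraic tensor product over $\mathbb{C}$; $[a,b]=ab-ba$. The noncommutative derivatives are the linear maps $\partial_j:\mathbb{C}\langle x_1,\dots,x_n\rangle\to\mathbb{C}\langle x_1,\dots,x_n\rangle\otimes\mathbb{C}\langle x_1,\dots,x_n\rangle$ with $\partial_j1=0$ and $\partial_j(x_{i_1}\cdots x_{i_k})=\sum_{p=1}^k\delta_{j,i_p}\,x_{i_1}\cdots x_{i_{p-1}}\otimes x_{i_{p+1}}\cdots x_{i_k}$. The cyclic derivatives are the linear maps $\mathcal{D}_j:\mathbb{C}\langle x_1,\dots,x_n\rangle\to\mathbb{C}\langle x_1,\dots,x_n\rangle$ with $\mathcal{D}_j1=0$ and $\mathcal{D}_j(x_{i_1}\cdots x_{i_k})=\sum_{p=1}^k\delta_{j,i_p}\,x_{i_{p+1}}\cdots x_{i_k}x_{i_1}\cdots x_{i_{p-1}}$. The number operator $N$ is the linear map on $\mathbb{C}\langle x_1,\dots,x_n\rangle$ with $N1=0$ and $N(x_{i_1}\cdots x_{i_k})=k\,x_{i_1}\cdots x_{i_k}$; $\mathrm{id}$ is the identity map. $\sigma$ is the flip, i.e., the linear map on $\mathbb{C}\langle x_1,\dots,x_n\rangle\otimes\mathbb{C}\langle x_1,\dots,x_n\rangle$ with $\sigma(a\otimes b)=b\otimes a$. *)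

(* Defs.v *)
From HB Require Import structures.
From mathcomp Require Import all_boot all_order all_algebra.
From mathcomp Require Import finmap.
From mathcomp Require Import reals.
From mathcomp.real_closed Require Import complex.
From mathcomp.multinomials Require Import monalg.

Set Implicit Arguments.
Unset Strict Implicit.
Unset Printing Implicit Defensive.

Import GRing.Theory.

Local Open Scope ring_scope.

(* The linear map from the vector space {malg F[K]} with basis K which takes
   the basis element k to h k. *)
Section LinearExtension.
Context {F : fieldType} {K : choiceType} {V : lmodType F}.
Implicit Types (h : K -> V) (g : {malg F[K]}).

Definition linext h g : V := \sum_(k <- msupp g) g@_k *: h k.

Lemma linextEw h g (d : {fset K}) : (msupp g `<=` d)%fset ->
  linext h g = \sum_(k <- d) g@_k *: h k.
Proof.
move=> le; rewrite /linext (big_fset_incl _ le) //= => k _ /mcoeff_outdom ->.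
by rewrite scale0r.
Qed.

Lemma linext_is_linear h : linear (linext h).
Proof.
move=> c g1 g2.
pose d := (msupp g1 `|` msupp g2 `|` msupp (c *: g1 + g2))%fset.
have le1 : (msupp g1 `<=` d)%fset.
  by apply/fsubsetP => k kg; rewrite !in_fsetU kg.
have le2 : (msupp g2 `<=` d)%fset.
  by apply/fsubsetP => k kg; rewrite !in_fsetU kg orbT.
have le3 : (msupp (c *: g1 + g2) `<=` d)%fset.
  by apply/fsubsetP => k kg; rewrite !in_fsetU kg !orbT.
rewrite (linextEw _ le1) (linextEw _ le2) (linextEw _ le3).
rewrite scaler_sumr -big_split /=; apply: eq_bigr => k _.
by rewrite mcoeffD mcoeffZ scalerDl scalerA.
Qed.

HB.instance Definition _ h :=
  GRing.isLinear.Build F {malg F[K]} V *:%R (linext h) (linext_is_linear h).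

Lemma linextU h k : linext h << k >> = h k.
Proof.
by rewrite (linextEw _ msuppU_le) big_seq_fset1 mcoeffUU scale1r.
Qed.

Lemma linext_unique (phi : {malg F[K]} -> V) :
  linear phi -> phi =1 linext (fun k => phi << k >>).
Proof.
move=> phiL g.
pose phiM := GRing.isLinear.Build F {malg F[K]} V *:%R phi phiL.
pose f : {linear {malg F[K]} -> V} := HB.pack phi phiM.
rewrite -[phi g]/(f g) {1}[g]monalgE linear_sum; apply: eq_bigr => k _ /=.
have -> : << g@_k *g k >> = g@_k *: (<< k >> : {malg F[K]}).
  by apply/malgP => x; rewrite mcoeffZ !mcoeffU mulr_natr.
exact: (linearZ_LR f).
Qed.

End LinearExtension.

(* An algebraic tensor product of the free vector spaces {malg F[K]} and
   {malg F[L]}: the free vector space on K * L.  Its universal property is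
   tensorPl, tensorPr and tensor_universal. *)
Section Tensor.
Context {F : fieldType} {K L : choiceType}.
Implicit Types (a : {malg F[K]}) (b : {malg F[L]}).

Definition tensor a b : {malg F[(K * L)%type]} :=
  \sum_(k <- msupp a) \sum_(l <- msupp b) << a@_k * b@_l *g (k, l) >>.

Lemma tensorEl a b :
  tensor a b = linext (fun k => \sum_(l <- msupp b) << b@_l *g (k, l) >>) a.
Proof.
apply: eq_bigr => k _; rewrite scaler_sumr; apply: eq_bigr => l _.
by apply/malgP => x; rewrite mcoeffZ !mcoeffU mulrnAr.
Qed.

Lemma tensorEr a b :
  tensor a b = linext (fun l => \sum_(k <- msupp a) << a@_k *g (k, l) >>) b.
Proof.
rewrite /tensor exchange_big /=.
apply: eq_bigr => l _; rewrite scaler_sumr; apply: eq_bigr => k _.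
by apply/malgP => x; rewrite mcoeffZ !mcoeffU mulrnAr mulrC.
Qed.

Lemma tensorPl b : linear (tensor^~ b).
Proof. by move=> c a1 a2; rewrite !tensorEl linearP. Qed.

Lemma tensorPr a : linear (tensor a).
Proof. by move=> c b1 b2; rewrite !tensorEr linearP. Qed.

Lemma tensorUU k l : tensor << k >> << l >> = << (k, l) >>.
Proof. by rewrite /tensor !msuppU !oner_eq0 !big_seq_fset1 !mcoeffUU mulr1. Qed.

Lemma tensor_universal (V : lmodType F) (B : {malg F[K]} -> {malg F[L]} -> V) :
    (forall b, linear (B^~ b)) -> (forall a, linear (B a)) ->
  exists2 f : {linear {malg F[(K * L)%type]} -> V},
    (forall a b, f (tensor a b) = B a b)
    & (forall g : {linear {malg F[(K * L)%type]} -> V},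
         (forall a b, g (tensor a b) = B a b) -> g =1 f).
Proof.
move=> Bl Br; exists (linext (fun kl => B << kl.1 >> << kl.2 >>)) => [a b|g gB].
  rewrite (linext_unique (Bl b)) tensorEl /linext linear_sum.
  apply: eq_bigr => k _ /=; rewrite linearZ /=; congr (_ *: _).
  rewrite (linext_unique (Br _)) linear_sum; apply: eq_bigr => l _ /=.
  have -> : << b@_l *g (k, l) >> = b@_l *: (<< (k, l) >> : {malg F[_]}).
    by apply/malgP => x; rewrite mcoeffZ !mcoeffU mulr_natr.
  by rewrite linearZ /= linextU.
move=> t; rewrite (linext_unique (linearP g)).
by apply: eq_bigr => -[k l] _; rewrite -tensorUU gB.
Qed.

End Tensor.

Section Flip.
Context {F : fieldType} {K : choiceType}.

Definition flip : {malg F[(K * K)%type]} -> {malg F[(K * K)%type]} :=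
  linext (fun kl => << (kl.2, kl.1) >>).

HB.instance Definition _ := GRing.Linear.on flip.

Lemma flip_tensor (a b : {malg F[K]}) : flip (tensor a b) = tensor b a.
Proof.
rewrite tensorEl [linext _ a]/linext linear_sum tensorEr; apply: eq_bigr => k _ /=.
rewrite linearZ /=; congr (_ *: _); rewrite linear_sum.
apply: eq_bigr => l _ /=; rewrite /flip.
have -> (x : K * K) : << b@_l *g x >> = b@_l *: (<< x >> : {malg F[_]}).
  by apply/malgP => y; rewrite mcoeffZ !mcoeffU mulr_natr.
rewrite linearZ /= linextU /=.
by apply/malgP => y; rewrite mcoeffZ !mcoeffU mulr_natr.
Qed.

End Flip.

(* The free algebra over F in n variables is the monoid algebra of the free
   monoid {fmonom 'I_n} of words in the letters 'I_n. *)
Notation ncpoly F n := {malg F[{fmonom 'I_n}]}.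
Notation ncpoly2 F n := {malg F[({fmonom 'I_n} * {fmonom 'I_n})%type]}.

Definition bracket (A : nzRingType) (a b : A) : A := a * b - b * a.

Section NCDerivatives.
Context {F : fieldType} {n : nat}.
Implicit Types (m : {fmonom 'I_n}) (j : 'I_n) (s : seq 'I_n).

Definition ncvar j : ncpoly F n := << fmu j >>.

Lemma ncwordE s : \prod_(i <- s) ncvar i = << FMonom s >> :> ncpoly F n.
Proof.
elim: s => [|i s IHs]; first by rewrite big_nil -fmoneE.
by rewrite big_cons IHs malgM_def fgmulUU mulr1 /ncvar fmuE [mmul _ _]fmmulE.
Qed.

Definition ncder_word j m : ncpoly2 F n :=
  \sum_(p < size m | tnth (in_tuple m) p == j)
    tensor << FMonom (take p m) >> << FMonom (drop p.+1 m) >>.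

Definition ncder j : ncpoly F n -> ncpoly2 F n := linext (ncder_word j).

Definition cycder_word j m : ncpoly F n :=
  \sum_(p < size m | tnth (in_tuple m) p == j)
    << FMonom (drop p.+1 m ++ take p m) >>.

Definition cycder j : ncpoly F n -> ncpoly F n := linext (cycder_word j).

Definition numop : ncpoly F n -> ncpoly F n :=
  linext (fun m => (size m)%:R *: << m >>).

HB.instance Definition _ j := GRing.Linear.on (ncder j).
HB.instance Definition _ j := GRing.Linear.on (cycder j).
HB.instance Definition _ := GRing.Linear.on numop.

Lemma ncder_monomial j s :
  ncder j (\prod_(i <- s) ncvar i) =
  \sum_(p < size s | tnth (in_tuple s) p == j)
    tensor (\prod_(i <- take p s) ncvar i) (\prod_(i <- drop p.+1 s) ncvar i).
Proof.
by rewrite ncwordE /ncder linextU; apply: eq_bigr => p _; rewrite !ncwordE.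
Qed.

Lemma cycder_monomial j s :
  cycder j (\prod_(i <- s) ncvar i) =
  \sum_(p < size s | tnth (in_tuple s) p == j)
    (\prod_(i <- drop p.+1 s) ncvar i) * (\prod_(i <- take p s) ncvar i).
Proof.
rewrite ncwordE /cycder linextU; apply: eq_bigr => p _.
by rewrite -big_cat ncwordE.
Qed.

Lemma numop_monomial s :
  numop (\prod_(i <- s) ncvar i) = (size s)%:R *: \prod_(i <- s) ncvar i.
Proof. by rewrite ncwordE /numop linextU. Qed.

Definition is_cyclic_gradient (p : 'I_n -> ncpoly F n) : Prop :=
  exists q, forall i, p i = cycder i q.

End NCDerivatives.

(* Main.v *)
(** Identify a polynomial with its coefficient function on words and put
    [Q = \sum_j x_j p_j], so that the coefficient of [p_j] at [w] is that of [Q]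
    at [j :: w].  Conditions (ii) and (iii) both say that the coefficients of [Q]
    are invariant under rotation of words, while the coefficient of [D_j q] at
    [w] is the sum of the coefficients of [q] over all the rotations of [j :: w].
    Such a sum is rotation invariant, which gives (i) -> (ii), and it equals
    [(|w| + 1)] times one term when [q = Q] is itself rotation invariant, which
    gives (iii) -> (iv).  Finally [D_j] lowers degrees by one, that is
    [D_j N = (N + id) D_j], and [N + id] is injective; hence (iv) and [N q = Q]
    together imply [D_j q = p_j], and [N q = Q] is solvable since [Q] has no
    constant term. *)

Require Import Defs.
From mathcomp Require Import all_boot all_order all_algebra.
From mathcomp Require Import finmap.
From mathcomp Require Import reals.
From mathcomp.real_closed Require Import complex.
From mathcomp.multinomials Require Import monalg.

Set Implicit Arguments.
Unset Strict Implicit.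
Unset Printing Implicit Defensive.

Import GRing.Theory.

Local Open Scope ring_scope.

(** * Rotations of words *)

Section Rotations.
Context {T : Type}.
Implicit Types m : seq T.

Lemma rotrS_rot1 k m : (k < size m)%N -> rotr k.+1 (rot 1 m) = rotr k m.
Proof.
move=> ltkm; rewrite -rot_rotr /rotr -rotS; first by rewrite subnSK.
by rewrite ltn_subrL (leq_ltn_trans _ ltkm).
Qed.

Lemma rot1_invariant_rot (S : Type) (f : seq T -> S) :
  (forall m, f (rot 1 m) = f m) -> forall k m, f (rot k m) = f m.
Proof.
move=> fP k m; elim: k => [|k IHk]; first by rewrite rot0.
by case: (ltnP k (size m)) => [/rotS->|?]; rewrite ?fP // rot_oversize // leqW.
Qed.

(** Replacing [m] by [rot 1 m] only shifts the list of rotations cyclically: its head [rot 1 m] is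
    the last rotation [rotr (size m).-1 m] of [m]. *)
Lemma sum_rotr_rot1 (V : nmodType) (f : seq T -> V) m :
  \sum_(k < size m) f (rotr k (rot 1 m)) = \sum_(k < size m) f (rotr k m).
Proof.
case szm: (size m) => [|s]; first by rewrite !big_ord0.
rewrite big_ord_recl big_ord_recr /= addrC; congr (_ + _).
  by apply: eq_bigr => k _; rewrite rotrS_rot1 // szm ltnW ?ltnS.
by rewrite /rotr size_rot subn0 szm subSnn rot_oversize // size_rot szm.
Qed.

End Rotations.

(** * Coefficients of linear extensions *)

Section Coefficients.
Context {F : fieldType}.

Lemma mcoeff_sum {K : choiceType} x {I : Type} (r : seq I) (P : pred I)
    (G : I -> {malg F[K]}) :
  (\sum_(i <- r | P i) G i)@_x = \sum_(i <- r | P i) (G i)@_x.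
Proof. exact: (raddf_sum (mcoeff x)). Qed.

(** The hypothesis describes row [x] of the matrix of [linext h], with weights [a i] at the
    positions [t i]. Repetitions among the [t i] are allowed, since rotations of a periodic word
    coincide. *)
Lemma mcoeff_linext {K L : choiceType} (h : K -> {malg F[L]}) (I : Type)
    (r : seq I) (a : I -> F) (t : I -> K) x (g : {malg F[K]}) :
    (forall k, (h k)@_x = \sum_(i <- r) a i * (k == t i)%:R) ->
  (linext h g)@_x = \sum_(i <- r) a i * g@_(t i).
Proof.
move=> hE; rewrite /linext (mcoeff_sum x).
under eq_bigr do rewrite mcoeffZ hE mulr_sumr.
rewrite exchange_big; apply: eq_bigr => i _ /=.
rewrite [g in RHS]monalgE (mcoeff_sum (t i)) mulr_sumr; apply: eq_bigr => k _ /=.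
by rewrite mcoeffU mulrCA mulr_natr.
Qed.

Lemma mcoeff_linext_diag {K : choiceType} (a : K -> F) (g : {malg F[K]}) x :
  (linext (fun k => a k *: << k >>) g)@_x = a x * g@_x.
Proof.
rewrite (@mcoeff_linext _ _ _ _ [:: x] a id) ?big_seq1 // => k.
rewrite big_seq1 mcoeffZ mcoeffU.
by case: eqVneq => [->|_]; rewrite // !mulr0.
Qed.

Lemma mcoeff_flip {K : choiceType} (g : {malg F[(K * K)%type]}) u v :
  (flip g)@_(u, v) = g@_(v, u).
Proof.
rewrite /flip (@mcoeff_linext _ _ _ _ [:: (v, u)] (fun=> 1) id).
  by rewrite big_seq1 mul1r.
by move=> [k l]; rewrite big_seq1 mul1r mcoeffU !xpair_eqE andbC.
Qed.

End Coefficients.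

(** * Coefficients of derivatives and products on words *)

Section Words.
Context {F : fieldType} {n : nat}.
Implicit Types (g q : ncpoly F n) (p : 'I_n -> ncpoly F n) (u v w : seq 'I_n).

Lemma mcoeff_numop q (m : {fmonom 'I_n}) : (numop q)@_m = (size m)%:R * q@_m.
Proof. exact: mcoeff_linext_diag. Qed.

(** Only the word [u ++ j :: v] can yield [u] and [v] by deleting a letter [j], and only at position
    [size u]. *)
Lemma mcoeff_ncder j g u v :
  (ncder j g)@_(FMonom u, FMonom v) = g@_(FMonom (u ++ j :: v)).
Proof.
rewrite /ncder (@mcoeff_linext _ _ _ _ _ [:: FMonom (u ++ j :: v)] (fun=> 1) id).
  by rewrite big_seq1 mul1r.
move=> [m]; rewrite big_seq1 mul1r /ncder_word.
rewrite (mcoeff_sum (FMonom u, FMonom v)) /= -val_eqE /=.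
under eq_bigr => k _ do rewrite tensorUU mcoeffU xpair_eqE -!val_eqE /=.
case: (eqVneq m (u ++ j :: v)) => [->|neq].
  have ltu : (size u < size (u ++ j :: v))%N.
    by rewrite size_cat /= addnS ltnS leq_addr.
  have dropu : drop (size u).+1 (u ++ j :: v) = v.
    by rewrite -cat_rcons drop_size_cat ?size_rcons.
  rewrite (bigD1 (Ordinal ltu)) /=; last first.
    by rewrite (tnth_nth j) /= nth_cat ltnn subnn.
  rewrite take_size_cat // dropu !eqxx.
  rewrite big1 ?addr0 // => k /andP[_ neqk]; case: eqP => //= tku.
  case/eqP: neqk; apply: val_inj => /=.
  by move: tku => /(congr1 size); rewrite size_takel // ltnW.
rewrite big1 // => k /eqP mk; case: eqP => //= tku; case: eqP => //= dkv.
case/eqP: neq; rewrite -[LHS](cat_take_drop k) (drop_nth j) // tku dkv.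
by rewrite -[in RHS]mk (tnth_nth j).
Qed.

(** Deleting a letter [j] at position [k] of [m] leaves [w] cyclically exactly when [rot k m] is
    [j :: w], that is, when [m] is [rotr k (j :: w)]. *)
Lemma mcoeff_cycder j q w :
  (cycder j q)@_(FMonom w) =
  \sum_(k < (size w).+1) q@_(FMonom (rotr k (j :: w))).
Proof.
rewrite /cycder (@mcoeff_linext _ _ _ _ _ (index_enum 'I_(size w).+1)
  (fun=> 1) (fun k => FMonom (rotr k (j :: w)))).
  by apply: eq_bigr => k _; rewrite mul1r.
move=> [m]; rewrite /cycder_word (mcoeff_sum (FMonom w)) big_mkcond /=.
have termE (k : 'I_(size m)) :
    (if tnth (in_tuple m) k == j
     then (<< FMonom (drop k.+1 m ++ take k m) >> : ncpoly F n)@_(FMonom w)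
     else 0) = (rot k m == j :: w)%:R.
  rewrite mcoeffU (tnth_nth j) /rot.
  rewrite (drop_nth j (ltn_ord k)) cat_cons eqseq_cons.
  by case: (_ == j).
under eq_bigr => k _ do rewrite termE.
under [RHS]eq_bigr => k _ do
  rewrite mul1r -val_eqE /= -(can2_eq (rotK k) (rotrK k)).
(* The index ranges agree only for equal lengths; otherwise no rotation matches and both sums
   vanish. *)
case: (eqVneq (size m) (size w).+1) => [->//|neq].
rewrite !big1 // => k _; case: eqP => // /(congr1 size)/eqP;
  by rewrite size_rot /= (negPf neq).
Qed.

Lemma mcoeff_ncvar_mul j g w :
  (ncvar j * g)@_(FMonom w) =
  if w is i :: v then (i == j)%:R * g@_(FMonom v) else 0.
Proof.
rewrite (mcoeffMlw _ msuppU_le (fsubset_refl _)) big_seq_fset1 mcoeffUU.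
under eq_bigr => m _ do rewrite mul1r -val_eqE fmuE [mmul _ _]fmmulE /=.
case: w => [|i v]; first by rewrite big1.
rewrite [g in RHS]monalgE (mcoeff_sum (FMonom v)) mulr_sumr.
apply: eq_bigr => m _; rewrite mcoeffU eqseq_cons eq_sym.
by case: (_ == j); rewrite ?mul1r ?mul0r.
Qed.

Lemma mcoeff_mul_ncvar j g w :
  (g * ncvar j)@_(FMonom (rot 1 w)) = (ncvar j * g)@_(FMonom w).
Proof.
rewrite mcoeff_ncvar_mul.
rewrite (mcoeffMrw _ (fsubset_refl _) msuppU_le) big_seq_fset1 mcoeffUU.
under eq_bigr => m _ do rewrite mulr1 -val_eqE fmuE [mmul _ _]fmmulE /= cats1.
case: w => [|i v].
  by rewrite big1 // => m _; case: eqP => // /(congr1 size); rewrite size_rcons.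
rewrite [g in RHS]monalgE (mcoeff_sum (FMonom v)) mulr_sumr.
apply: eq_bigr => m _; rewrite mcoeffU rot1_cons eqseq_rcons andbC eq_sym.
by case: (_ == j); rewrite ?mul1r ?mul0r.
Qed.

Lemma mcoeff_sum_ncvar_mul p w :
  (\sum_(j < n) ncvar j * p j)@_(FMonom w) =
  if w is j :: v then (p j)@_(FMonom v) else 0.
Proof.
rewrite (mcoeff_sum (FMonom w)).
under eq_bigr do rewrite mcoeff_ncvar_mul.
case: w => [|i v]; first by rewrite big1.
rewrite (bigD1 i) //= eqxx mul1r big1 ?addr0 // => j /negPf neqji.
by rewrite eq_sym neqji mul0r.
Qed.

(** Moving the factor [ncvar j] from left to right rotates words by one letter. *)
Lemma sum_bracket_eq0P p :
  \sum_(j < n) bracket (ncvar j) (p j) = 0 <->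
  forall w, (\sum_(j < n) ncvar j * p j)@_(FMonom (rot 1 w)) =
            (\sum_(j < n) ncvar j * p j)@_(FMonom w).
Proof.
set Q := \sum_(j < n) ncvar j * p j.
have rotQ w : (\sum_(j < n) p j * ncvar j)@_(FMonom (rot 1 w)) = Q@_(FMonom w).
  rewrite (mcoeff_sum (FMonom (rot 1 w))) (mcoeff_sum (FMonom w)).
  by apply: eq_bigr => j _; exact: mcoeff_mul_ncvar.
rewrite /bracket sumrB -/Q; split=> [/subr0_eq QE w|QP].
  by rewrite -(rotQ w) -QE.
apply/eqP; rewrite subr_eq0; apply/eqP/malgP => -[w].
by rewrite -[w](rotrK 1) rotQ QP.
Qed.

Lemma cycder_numop j q : cycder j (numop q) = numop (cycder j q) + cycder j q.
Proof.
apply/malgP => -[w]; rewrite mcoeffD mcoeff_numop !mcoeff_cycder /=.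
rewrite mulr_sumr -big_split; apply: eq_bigr => k _ /=.
by rewrite mcoeff_numop /= size_rotr /= -natr1 mulrDl mul1r.
Qed.

Lemma cyclic_gradient_sum_bracket p :
  is_cyclic_gradient p -> \sum_(j < n) bracket (ncvar j) (p j) = 0.
Proof.
case=> q pE; apply/sum_bracket_eq0P => w.
have QE v : (\sum_(j < n) ncvar j * p j)@_(FMonom v) =
    \sum_(k < size v) q@_(FMonom (rotr k v)).
  rewrite mcoeff_sum_ncvar_mul; case: v => [|j v]; first by rewrite big_ord0.
  by rewrite pE mcoeff_cycder.
by rewrite !QE size_rot (sum_rotr_rot1 (fun v => q@_(FMonom v))).
Qed.

Lemma sum_bracket_ncder p : \sum_(j < n) bracket (ncvar j) (p j) = 0 ->
  forall i j, ncder i (p j) = flip (ncder j (p i)).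
Proof.
move=> /sum_bracket_eq0P/rot1_invariant_rot QP i j.
apply/malgP => -[[u] [v]]; rewrite mcoeff_flip !mcoeff_ncder.
(* Rotating past [j :: u] swaps the two blocks, and removing the leading letters leaves the
   coefficients of [p j] and [p i]. *)
have := QP (size (j :: u)) ((j :: u) ++ i :: v).
by rewrite rot_size_cat !mcoeff_sum_ncvar_mul /= => ->.
Qed.

Lemma ncder_cycder p :
    (forall i j, ncder i (p j) = flip (ncder j (p i))) ->
  forall i, cycder i (\sum_(j < n) ncvar j * p j) = (numop \+ idfun) (p i).
Proof.
move=> pP; set Q := \sum_(j < n) ncvar j * p j.
have pE i u j v : (p j)@_(FMonom (u ++ i :: v)) = (p i)@_(FMonom (v ++ j :: u)).
  by rewrite -!mcoeff_ncder pP mcoeff_flip.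
have QP k w : Q@_(FMonom (rot k w)) = Q@_(FMonom w).
  rewrite -[w in RHS](cat_take_drop k) /rot !mcoeff_sum_ncvar_mul.
  (* If one block is empty, the rotation is trivial; two nonempty blocks are swapped by [pE]. *)
  by case: (take k w) (drop k w) => [|j u] [|i v]; rewrite /= ?cats0 // pE.
move=> i; apply/malgP => -[w]; rewrite mcoeff_cycder mcoeffD mcoeff_numop /=.
under eq_bigr => k _ do rewrite /rotr QP mcoeff_sum_ncvar_mul.
by rewrite sumr_const card_ord mulrSr mulr_natl.
Qed.

End Words.

(** * Inverting the number operator in characteristic zero *)

Section CharacteristicZero.
Context {F : numFieldType} {n : nat}.
Implicit Types (q : ncpoly F n) (p : 'I_n -> ncpoly F n).

Lemma numop_succ_inj : injective (fun q => numop q + q).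
Proof.
move=> q1 q2 /malgP eqN; apply/malgP => m; move: (eqN m).
rewrite !mcoeffD !mcoeff_numop -{2}[q1@_m]mul1r -{2}[q2@_m]mul1r -!mulrDl natr1.
by apply: mulfI; rewrite Num.Theory.pnatr_eq0.
Qed.

Lemma numop_surj p : exists q, numop q = \sum_(j < n) ncvar j * p j.
Proof.
set Q := \sum_(j < n) ncvar j * p j.
exists (linext (fun m : {fmonom 'I_n} => (size m)%:R^-1 *: << m >>) Q).
apply/malgP => -[w]; rewrite mcoeff_numop.
rewrite (mcoeff_linext_diag (fun m : {fmonom 'I_n} => (size m)%:R^-1)).
(* At the empty word the inverse of zero is multiplied by zero, which is harmless because [Q] has no
   constant term. *)
case: w => [|j w]; first by rewrite mul0r mcoeff_sum_ncvar_mul.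
by rewrite mulVKf // Num.Theory.pnatr_eq0.
Qed.

Lemma cycder_numop_inv p q :
    (forall i, cycder i (\sum_(j < n) ncvar j * p j) = (numop \+ idfun) (p i)) ->
    numop q = \sum_(j < n) ncvar j * p j ->
  forall i, cycder i q = p i.
Proof.
by move=> pP qE i; apply: numop_succ_inj; rewrite -cycder_numop qE pP.
Qed.

End CharacteristicZero.

Theorem theorem1p1 (R : realType) (n : nat) (n_ge1 : (1 <= n)%N)
    (p : 'I_n -> ncpoly R[i] n) :
  [<-> is_cyclic_gradient p;
       \sum_(j < n) bracket (ncvar j) (p j) = 0;
       forall i j : 'I_n, ncder i (p j) = flip (ncder j (p i));
       forall i : 'I_n,
         cycder i (\sum_(j < n) ncvar j * p j) = (numop \+ idfun) (p i)]
  /\ (is_cyclic_gradient p ->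
      (exists q : ncpoly R[i] n, numop q = \sum_(j < n) ncvar j * p j)
      /\ (forall q : ncpoly R[i] n,
            numop q = \sum_(j < n) ncvar j * p j ->
            forall i : 'I_n, cycder i q = p i)).
Proof.
split.
  tfae; [exact: cyclic_gradient_sum_bracket | exact: sum_bracket_ncder
    | exact: ncder_cycder | move=> pP].
  have [q qE] := numop_surj p.
  by exists q => i; rewrite (cycder_numop_inv pP qE).
move=> /cyclic_gradient_sum_bracket/sum_bracket_ncder/ncder_cycder pP.
by split; [exact: numop_surj | move=> q; exact: cycder_numop_inv].
Qed.
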